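(* Let $m\ge 1$, let $A,B,C\in\mathbb{R}^{m\times m}$, and let $P_1,\dots,P_{m!}$ be the $m\times m$ permutation matrices. For $1\le k\le m!$ and $X\in\mathbb{R}^{m\times m}$ put $f_k^{(P)}(X)=P_kXP_k^\top$ and $f_k^{(R)}(X)=P_kX^\top P_k^\top$. Then for each $1\le k\le m!$: (a) For $f=f_k^{(P)}$, the equation $AX+f(X)B=C$ has a unique solution $X\in\mathbb{R}^{m\times m}$ if and only if $\sigma(P_k^\top A)\cap\sigma(-P_k^\top B)=\emptyset$. (b) For $f=f_k^{(R)}$, the equation $AX+f(X)B=C$ has a unique solution $X\in\mathbb{R}^{m\times m}$ if and only if both of the following hold: (1) whenever $\lambda_1,\lambda_2\in\sigma(P_k^\top A-\lambda B^\top P_k)\setminus\{1\}$ (the case $\lambda_1=\lambda_2$ being included), one has $\lambda_1\lambda_2\neq 1$, where $0$ and $\infty$ are regarded as reciprocals of each other (so $0$ and $\infty$ may not both belong to the spectrum); (2) $1$ may be an eigenvalue of the pencil $P_k^\top A-\lambda B^\top P_k$, but if it is, it must be simple.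
   Context: For a square matrix $M$, $\sigma(M)\subset\mathbb{C}$ is its set of (complex) eigenvalues. For a pencil $D-\lambda E$ of $m\times m$ matrices, $\sigma(D-\lambda E)\subset\mathbb{C}\cup\{\infty\}$ is its spectrum: it consists of all $\lambda\in\mathbb{C}$ with $\det(D-\lambda E)=0$, together with $\infty$ if $\det E=0$. A finite eigenvalue is simple if it is a simple root of the polynomial $\det(D-\lambda E)$ in $\lambda$. The matrices $P_1,\dots,P_{m!}$ are indexed as follows: the permutations of $\{1,\dots,m\}$ are listed in lexicographical order, and the $j$th row of $P_k$ is $e_{\pi_k(j)}^\top$, where $\pi_k$ is the $k$th permutation and $e_i$ is the $i$th column of the $m\times m$ identity matrix. *)

(* Defs.v *)
From mathcomp Require Import all_boot all_order all_fingroup all_algebra.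
From mathcomp Require Import classical_sets reals.
From mathcomp Require Import complex.

Set Implicit Arguments.
Unset Strict Implicit.
Unset Printing Implicit Defensive.

Import Order.TTheory GRing.Theory Num.Theory.
Local Open Scope classical_set_scope.
Local Open Scope ring_scope.

(* The word (s 0, ..., s (m-1)), carrying the lexicographic order. *)
Definition perm_word (m : nat) (s : 'S_m) : seqlexi nat :=
  [seq val (s i) | i <- enum 'I_m].

Definition lex_perms (m : nat) : seq 'S_m :=
  sort (fun s t : 'S_m => (perm_word s <= perm_word t)%O) (enum 'S_m).

(* Permutations are numbered from 1, as k ranges over 1, ..., m!.
   Row j of [perm_mx s] is the unit row vector with its 1 in column [s j]. *)
Definition perm_P (R : nzRingType) (m k : nat) : 'M[R]_m :=
  perm_mx (nth 1%g (lex_perms m) k.-1).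

Definition fP (R : nzRingType) (m k : nat) (X : 'M[R]_m) : 'M[R]_m :=
  perm_P R m k *m X *m (perm_P R m k)^T.

Definition fR (R : nzRingType) (m k : nat) (X : 'M[R]_m) : 'M[R]_m :=
  perm_P R m k *m X^T *m (perm_P R m k)^T.

Definition complexify (R : realType) (m : nat) (M : 'M[R]_m) : 'M[R[i]]_m :=
  map_mx (real_complex R) M.

Definition spectrum (R : realType) (m : nat) (M : 'M[R]_m) : set R[i] :=
  [set z | eigenvalue (complexify M) z].

(* det (D - 'X E) *)
Definition pencil_poly (R : realType) (m : nat) (D E : 'M[R]_m) :
    {poly R[i]} :=
  \det (map_mx polyC (complexify D) - 'X *: map_mx polyC (complexify E)).

(* In [option R[i]], [None] stands for the point at infinity. *)
Definition pencil_spectrum (R : realType) (m : nat) (D E : 'M[R]_m) :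
    set (option R[i]) :=
  [set l | match l with
           | Some z => \det (complexify D - z *: complexify E) = 0
           | None => \det (complexify E) = 0
           end].

Definition simple_eigenvalue (R : realType) (m : nat) (D E : 'M[R]_m)
    (z : R[i]) : Prop :=
  mup z (pencil_poly D E) = 1%N.

Definition reciprocal (F : fieldType) (x y : option F) : Prop :=
  match x, y with
  | Some a, Some b => a * b = 1
  | Some a, None => a = 0
  | None, Some b => b = 0
  | None, None => False
  end.

(* Main.v *)
(* Multiplying by P^T turns the equations into D X + X G = P^T C and
   D X + X^T E^T = P^T C with D = P^T A, G = P^T B, E = B^T P.  Unique
   solvability is triviality of the kernel, which may be tested over the
   complex numbers.

   Sylvester: eigenvectors D x = z x and y G = - z y give the kernel element
   x y; conversely D X + X G = 0 forces X = 0 by peeling off, one after the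
   other, the linear factors of the characteristic polynomial of D.

   T-Sylvester, a forbidden eigenvalue gives a kernel element: with D x = l E x
   and D y = mu E y, l mu = 1, take x (E y)^T - l y (E x)^T (or x (E x)^T if
   l = mu = -1); for the pair 0, oo take x (D y)^T - y (E x)^T.  Differentiating
   adj(D - t E) (D - t E) = det(D - t E) at t = 1 shows that 1 fails to be
   simple exactly if D - E has a two-dimensional kernel or there is a Jordan
   chain D z = E z + E x; the kernel elements are then x (E z)^T - z (E x)^T and
   x (E x)^T + 2 x (E z)^T - 2 z (E x)^T.

   T-Sylvester, converse: as 0 and oo are not both in the spectrum, one may
   exchange D and E and normalise to E = 1, so that X^T = - D X and
   X = D X D^T.  Peeling off the characteristic polynomial of D leaves
   D X = X, hence X is antisymmetric with columns in ker(D - 1); if X i j <> 0,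
   its columns i and j are independent, against simplicity of 1. *)

Require Import Defs.
From HB Require Import structures.
From mathcomp Require Import all_boot all_order all_fingroup all_algebra.
From mathcomp Require Import classical_sets reals.
From mathcomp Require Import complex.
From mathcomp Require Import ring.
Set Implicit Arguments.
Unset Strict Implicit.
Unset Printing Implicit Defensive.
Import GRing.Theory Num.Theory.
Local Open Scope classical_set_scope.
Local Open Scope ring_scope.

(** * Simple eigenvalues of a pencil *)

Lemma outer_eq0 (F : fieldType) (n : nat) (u v : 'cV[F]_n) :
  u *m v^T = 0 -> u = 0 \/ v = 0.
Proof.
move=> uv0; case: (eqVneq u 0) => [|/cV0Pn[i ui]]; [by left|right].
apply/colP => j; rewrite mxE; move/matrixP/(_ i j): uv0.
by rewrite !mxE big_ord1 mxE => /eqP; rewrite mulf_eq0 (negPf ui) => /eqP.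
Qed.

Lemma det_eq0P (F : fieldType) (n : nat) (M : 'M[F]_n) :
  \det M = 0 <-> exists2 x : 'cV[F]_n, x != 0 & M *m x = 0.
Proof.
rewrite -det_tr; split=> [/eqP/det0P[v v0 vM]|[x x0 Mx]].
  by exists v^T; rewrite ?trmx_eq0 // -[LHS]trmxK trmx_mul trmxK vM trmx0.
by apply/eqP/det0P; exists x^T; rewrite ?trmx_eq0 // -trmx_mul Mx trmx0.
Qed.

(* The index j certifies that x and z are linearly independent. *)
Definition plane_kernel (F : fieldType) (n : nat) (M : 'M[F]_n) : Prop :=
  exists (x z : 'cV[F]_n) (j : 'I_n),
    [/\ M *m x = 0, M *m z = 0, x j 0 != 0, z j 0 = 0 & z != 0].

(** A Jordan chain of length two at the eigenvalue 1: [- E] is the derivative of D - t E in t, hence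
    [E *m x1] on the right. *)
Definition jordan_chain (F : fieldType) (n : nat) (D E : 'M[F]_n) : Prop :=
  exists x1 x2 : 'cV[F]_n,
    [/\ x1 != 0, (D - E) *m x1 = 0 & (D - E) *m x2 = E *m x1].

Lemma mulmx_col'_row' (F : fieldType) (n m p : nat) (M : 'M[F]_(n, m))
    (j : 'I_m) (x : 'M[F]_(m, p)) :
  M *m x = col j M *m row j x + col' j M *m row' j x.
Proof.
apply/matrixP => i k; rewrite !mxE (bigD1_ord j) //= big_ord1 !mxE.
by congr (_ + _); apply: eq_bigr => l _; rewrite !mxE.
Qed.

(** A kernel vector of the submatrix, padded with 0 at [j], is killed by every row of [M] other than
    row [i]; as [y i 0 != 0], the relation [y^T *m M = 0] makes row [i] a combination of the others,
    so it is killed by row [i] too. *)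
Lemma minor_plane_kernel (F : fieldType) (n : nat) (M : 'M[F]_n) (i j : 'I_n)
    (x y : 'cV[F]_n) :
  M *m x = 0 -> x j 0 != 0 -> y^T *m M = 0 -> y i 0 != 0 ->
  \det (row' i (col' j M)) = 0 -> plane_kernel M.
Proof.
move=> Mx xj yM yi /det_eq0P[z z0 Mz].
pose z' : 'cV[F]_n := \col_k (if unlift j k is Some l then z l 0 else 0).
have rz' : row' j z' = z by apply/colP => l; rewrite !mxE liftK.
have z'j : z' j 0 = 0 by rewrite mxE unlift_none.
have Mz' : M *m z' = col' j M *m z.
  rewrite (mulmx_col'_row' _ j) rz'; have -> : row j z' = 0.
    by apply/matrixP => a b; rewrite [LHS]mxE ord1 z'j mxE.
  by rewrite mulmx0 add0r.
exists x, z', j; split => //; last first.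
  apply: contra_neq z0 => z0; rewrite -rz' z0.
  by apply/matrixP => a b; rewrite !mxE.
have Mz'l l : (M *m z') (lift i l) 0 = 0.
  move/colP/(_ l): Mz; rewrite Mz' !mxE => {2}<-.
  by apply: eq_bigr => a _; rewrite !mxE.
have Mz'i : (M *m z') i 0 = 0.
  have : y^T *m (M *m z') = 0 by rewrite mulmxA yM mul0mx.
  move/matrixP/(_ 0 0); rewrite [LHS]mxE (bigD1_ord i) //= big1 ?addr0.
    by rewrite !mxE => /eqP; rewrite mulf_eq0 (negPf yi) => /eqP.
  by move=> l _; rewrite Mz'l mulr0.
by apply/colP => k; rewrite [RHS]mxE; case: (unliftP i k) => [l ->|->].
Qed.

(** Take [j] and [i] in the supports of a right and a left kernel vector; entry (j, i) of the
    adjugate is, up to sign, the minor without row [i] and column [j]. *)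
Lemma adj_eq0_plane_kernel (F : fieldType) (n : nat) (M : 'M[F]_n) :
  \det M = 0 -> \adj M = 0 -> plane_kernel M.
Proof.
move=> M0 aM0; have [x /cV0Pn[j xj] Mx] := (det_eq0P M).1 M0.
have [y /cV0Pn[i yi] yM] : exists2 y : 'cV[F]_n, y != 0 & M^T *m y = 0.
  by apply/det_eq0P; rewrite det_tr.
apply: (minor_plane_kernel Mx xj _ yi).
  by rewrite -[LHS]trmxK trmx_mul trmxK yM trmx0.
move/matrixP/(_ j i): aM0; rewrite !mxE /cofactor => /eqP.
by rewrite mulf_eq0 signr_eq0 => /eqP.
Qed.

(** Two independent kernel vectors combine to a nonzero one that vanishes at any given [j'];
    dropping that entry gives a kernel vector of every submatrix without column [j']. *)
Lemma plane_kernel_adj (F : fieldType) (n : nat) (M : 'M[F]_n) :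
  plane_kernel M -> \adj M = 0.
Proof.
case=> x [z [j [Mx Mz xj zj z0]]]; apply/matrixP => j' i; rewrite !mxE /cofactor.
have [v [v0 Mv vj']] : exists v : 'cV[F]_n, [/\ v != 0, M *m v = 0 & v j' 0 = 0].
  have [zj'|zj'] := eqVneq (z j' 0) 0; first by exists z.
  exists (x j' 0 *: z - z j' 0 *: x); split.
  - apply/eqP => /matrixP/(_ j 0)/eqP; rewrite !mxE zj mulr0 sub0r oppr_eq0.
    by rewrite mulf_eq0 (negPf zj') (negPf xj).
  - by rewrite mulmxBr -!scalemxAr Mx Mz !scaler0 subrr.
  - by rewrite !mxE mulrC subrr.
rewrite (_ : \det _ = 0) ?mulr0 //; apply/det_eq0P; exists (row' j' v).
  apply: contra_neq v0 => rv; apply/colP => k; rewrite [RHS]mxE.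
  case: (unliftP j' k) => [l ->|->] //; move/colP/(_ l): rv.
  by rewrite !mxE.
have rv : row j' v = 0 by apply/matrixP => a b; rewrite [LHS]mxE ord1 vj' mxE.
move: Mv; rewrite (mulmx_col'_row' _ j') rv mulmx0 add0r => Mv.
apply/colP => l; move/colP/(_ (lift i l)): Mv; rewrite !mxE => {2}<-.
by apply: eq_bigr => a _; rewrite !mxE.
Qed.

(** * Polynomial matrices and the derivative of the determinant *)

Definition pencil_mx (F : fieldType) (n : nat) (D E : 'M[F]_n) :
    'M[{poly F}]_n :=
  map_mx polyC D - 'X *: map_mx polyC E.

Lemma horner_pencil_mx (F : fieldType) (n : nat) (D E : 'M[F]_n) (c : F) :
  map_mx (horner_eval c) (pencil_mx D E) = D - c *: E.
Proof.
by apply/matrixP => i j; rewrite !mxE /horner_eval !hornerE.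
Qed.

Lemma horner_det_pencil (F : fieldType) (n : nat) (D E : 'M[F]_n) (c : F) :
  (\det (pencil_mx D E)).[c] = \det (D - c *: E).
Proof. by rewrite -(horner_pencil_mx D E c) det_map_mx. Qed.

Lemma horner_adj_pencil (F : fieldType) (n : nat) (D E : 'M[F]_n) (c : F) :
  map_mx (horner_eval c) (\adj (pencil_mx D E)) = \adj (D - c *: E).
Proof. by rewrite -(horner_pencil_mx D E c) map_mx_adj. Qed.

Lemma deriv_mulmx (R : nzRingType) (m n p : nat) (A : 'M[{poly R}]_(m, n))
    (B : 'M[{poly R}]_(n, p)) :
  map_mx deriv (A *m B) = map_mx deriv A *m B + A *m map_mx deriv B.
Proof.
apply/matrixP => i j; rewrite !mxE raddf_sum -big_split.
by apply: eq_bigr => k _; rewrite /= !mxE derivM.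
Qed.

Lemma deriv_pencil_mx (F : fieldType) (n : nat) (D E : 'M[F]_n) :
  map_mx deriv (pencil_mx D E) = - map_mx polyC E.
Proof.
apply/matrixP => i j; rewrite !mxE derivB derivM derivX !derivC.
by rewrite mul1r mulr0 addr0 sub0r.
Qed.

Lemma horner_map_polyC (F : fieldType) (n : nat) (c : F) (E : 'M[F]_n) :
  map_mx (horner_eval c) (map_mx polyC E) = E.
Proof. by apply/matrixP => i j; rewrite !mxE /horner_eval hornerC. Qed.

Lemma horner_deriv_scalar (F : fieldType) (n : nat) (c : F) (p : {poly F}) :
  map_mx (horner_eval c) (map_mx deriv (p%:M : 'M_n)) = (p^`().[c])%:M.
Proof.
by apply/matrixP => i j; rewrite !mxE /horner_eval derivMn hornerMn.
Qed.

(* A' is the derivative of the adjugate at c: both identities differentiate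
   M adj(M) = adj(M) M = det M. *)
Lemma deriv_pencil_adj (F : fieldType) (n : nat) (D E : 'M[F]_n) (c : F) :
  exists A' : 'M[F]_n,
    (D - c *: E) *m A' - E *m \adj (D - c *: E)
      = ((\det (pencil_mx D E))^`().[c])%:M
  /\ A' *m (D - c *: E) - \adj (D - c *: E) *m E
      = ((\det (pencil_mx D E))^`().[c])%:M.
Proof.
exists (map_mx (horner_eval c) (map_mx deriv (\adj (pencil_mx D E)))).
rewrite -!horner_deriv_scalar -{1}mul_mx_adj -mul_adj_mx !deriv_mulmx.
rewrite deriv_pencil_mx !map_mxD !map_mxM !map_mxN !horner_map_polyC.
rewrite horner_pencil_mx horner_adj_pencil mulmxN mulNmx addrC.
by split=> //; rewrite addrC.
Qed.

Lemma simple_root_pencil (F : fieldType) (n : nat) (D E : 'M[F]_n) :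
  \det (pencil_mx D E) != 0 -> \det (D - E) = 0 ->
  mup 1 (\det (pencil_mx D E)) = 1%N <->
  ~ plane_kernel (D - E) /\ ~ jordan_chain D E.
Proof.
move=> p0 DE0; have h1 := horner_det_pencil D E 1.
have e1 : D - 1 *: E = D - E by rewrite scale1r.
rewrite e1 DE0 in h1.
have rp : root (\det (pencil_mx D E)) 1 by rewrite rootE h1.
have [A' [dl dr]] := deriv_pencil_adj D E 1; rewrite e1 in dl dr.
(* Write the determinant as q (X - 1): its derivative at 1 is q(1), and 1 is a simple root exactly
   if q(1) is nonzero. *)
have mp : mup 1 (\det (pencil_mx D E)) = 1%N <->
    (\det (pencil_mx D E))^`().[1] != 0.
  have := rp; rewrite root_factor_theorem => /dvdpP[q pq].
  have q0 : q != 0 by apply: contra_neq p0; rewrite pq => ->; rewrite mul0r.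
  rewrite pq mupM ?polyXsubC_eq0 // -[X in (_ + mup 1 X)%N]expr1 mup_XsubCX.
  rewrite eqxx addn1 derivM derivXsubC !hornerE subrr mulr0 add0r -rootE.
  split=> [[mq]|/mupNroot ->//]; apply/negP.
  by rewrite root_factor_theorem XsubC_dvd // mq.
(* Identity [dr] applied to [x]: both terms on its left vanish, so p'(1) x = 0. For a chain, adj(D -
   E) E x1 = adj(D - E) (D - E) x2 = 0. *)
have p1x (x : 'cV[F]_n) : (D - E) *m x = 0 -> \adj (D - E) *m (E *m x) = 0 ->
    (\det (pencil_mx D E))^`().[1] != 0 -> x = 0.
  move=> Mx aEx p1; move/(congr1 (mulmx^~ x)): dr.
  rewrite mulmxBl -!mulmxA Mx aEx mulmx0 subrr mul_scalar_mx => /esym/eqP.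
  by rewrite scaler_eq0 (negPf p1) => /eqP.
split=> [/mp p1|[nplane nchain]].
  split=> [pk|[x1 [x2 [x10 Mx1 Mx2]]]].
    have [x [_ [j [Mx _ xj _ _]]]] := pk.
    move: xj; rewrite (p1x _ Mx _ p1) ?mxE ?eqxx //.
    by rewrite plane_kernel_adj // mul0mx.
  move: x10; rewrite (p1x _ Mx1 _ p1) ?eqxx //.
  by rewrite -Mx2 mulmxA mul_adj_mx DE0 mul_scalar_mx scale0r.
(* With p'(1) = 0, [dl] reads (D - E) A' = E adj(D - E): a nonzero column of the adjugate and the
   same column of [A'] form a Jordan chain. *)
apply/mp/eqP => p1; case: nplane; apply: adj_eq0_plane_kernel => //.
apply/matrixP => i j; rewrite [RHS]mxE.
apply/eqP; case: eqP => // /eqP aij; case: nchain.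
exists (col j (\adj (D - E))), (col j A'); split.
- by apply/cV0Pn; exists i; rewrite mxE.
- by rewrite colE mulmxA mul_mx_adj DE0 mul_scalar_mx scale0r.
- rewrite !colE !mulmxA; congr (_ *m _); apply/eqP; rewrite -subr_eq0 dl p1.
  by rewrite -scalemx1 scale0r.
Qed.

(** * Kernel elements from eigenvectors *)

(** Writing X^T E^T as [(E *m X)^T] makes the exchange of [D] and [E] a transposition. *)
Definition star_sylvester (F : fieldType) (n : nat) (D E X : 'M[F]_n) : 'M[F]_n :=
  D *m X + (E *m X)^T.

Definition trivial_kernel (F : fieldType) (n : nat) (L : 'M[F]_n -> 'M[F]_n) :
    Prop :=
  forall X, L X = 0 -> X = 0.

Lemma outerE (F : fieldType) (n : nat) (u v : 'cV[F]_n) i j :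
  (u *m v^T) i j = u i 0 * v j 0.
Proof. by rewrite mxE big_ord1 mxE. Qed.

Lemma star_sylvester_outer (F : fieldType) (n : nat) (D E : 'M[F]_n)
    (u v : 'cV[F]_n) :
  star_sylvester D E (u *m v^T) = (D *m u) *m v^T + v *m (E *m u)^T.
Proof. by rewrite /star_sylvester !mulmxA trmx_mul trmxK. Qed.

Lemma star_sylvesterD (F : fieldType) (n : nat) (D E X Y : 'M[F]_n) :
  star_sylvester D E (X + Y) = star_sylvester D E X + star_sylvester D E Y.
Proof. by rewrite /star_sylvester !mulmxDr linearD /= addrACA. Qed.

Lemma star_sylvesterZ (F : fieldType) (n : nat) (D E X : 'M[F]_n) c :
  star_sylvester D E (c *: X) = c *: star_sylvester D E X.
Proof. by rewrite /star_sylvester -!scalemxAr linearZ /= scalerDr. Qed.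

(** The kernel element is x x^T. Below, this ensures that the factors [E *m x] of the outer products
    are nonzero. *)
Lemma trivial_common_kernel (F : fieldType) (n : nat) (D E : 'M[F]_n)
    (x : 'cV[F]_n) :
  trivial_kernel (star_sylvester D E) -> D *m x = 0 -> E *m x = 0 -> x = 0.
Proof.
move=> tk Dx Ex; have : x *m x^T = 0.
  by apply: tk; rewrite star_sylvester_outer Dx Ex mul0mx trmx0 mulmx0 addr0.
by case/outer_eq0.
Qed.

Lemma trivial_reciprocal (F : fieldType) (n : nat) (D E : 'M[F]_n) (l mu : F) :
  trivial_kernel (star_sylvester D E) ->
  \det (D - l *: E) = 0 -> \det (D - mu *: E) = 0 -> l * mu = 1 -> l = 1.
Proof.
move=> tk /det_eq0P[x x0 Mx] /det_eq0P[y y0 My] lmu.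
have Dx : D *m x = l *: (E *m x).
  by apply/eqP; rewrite -subr_eq0 scalemxAl -mulmxBl Mx.
have Dy : D *m y = mu *: (E *m y).
  by apply/eqP; rewrite -subr_eq0 scalemxAl -mulmxBl My.
have Ex0 : E *m x != 0.
  apply: contra_neq x0 => Ex; apply: (trivial_common_kernel tk) => //.
  by rewrite Dx Ex scaler0.
have Ey0 : E *m y != 0.
  apply: contra_neq y0 => Ey; apply: (trivial_common_kernel tk) => //.
  by rewrite Dy Ey scaler0.
have [lm|nlm] := eqVneq l mu.
  have /eqP := lmu; rewrite -lm -expr2 sqrf_eq1 => /orP[/eqP //|/eqP l1].
  have /outer_eq0[x00|Ex00] : x *m (E *m x)^T = 0.
    apply: tk; rewrite star_sylvester_outer Dx l1 scaleN1r mulNmx.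
    by rewrite addNr.
  - by rewrite x00 eqxx in x0.
  - by rewrite Ex00 eqxx in Ex0.
have : x *m (E *m y)^T + (- l) *: (y *m (E *m x)^T) = 0.
  apply: tk; rewrite star_sylvesterD star_sylvesterZ !star_sylvester_outer Dx Dy.
  apply/matrixP => i j; rewrite !(mxE, outerE, big_ord1).
  set a := \sum_(_ < _) _; set b := \sum_(_ < _) _.
  set a' := \sum_(_ < _) _; set b' := \sum_(_ < _) _.
  by ring: lmu.
move=> X0.
(* Applying [D] and [E] gives two relations between w v^T and v w^T; eliminating the former leaves
   (l - mu) l v w^T = 0. *)
have D0 := congr1 (mulmx D) X0; have E0 := congr1 (mulmx E) X0.
move: D0 E0; rewrite !mulmxDr -!scalemxAr !mulmxA Dx Dy !mulmx0.
set w := E *m x; set v := E *m y => D0 E0.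
have /outer_eq0[v0|w0] : v *m w^T = 0.
  apply/eqP; have : (l - mu) *: (l *: (v *m w^T)) = 0.
    transitivity (((l *: w) *m v^T + - l *: ((mu *: v) *m w^T))
                  - l *: (w *m v^T + - l *: (v *m w^T))).
      apply/matrixP => i j; rewrite !(mxE, outerE, big_ord1).
      by ring: lmu.
    by rewrite D0 E0 scaler0 subr0.
  move/eqP; rewrite !scaler_eq0 subr_eq0 (negPf nlm) /= => /orP[/eqP l0|//].
  by move: lmu (oner_eq0 F); rewrite l0 mul0r => <-; rewrite eqxx.
- by rewrite /v in v0; rewrite v0 eqxx in Ey0.
- by rewrite /w in w0; rewrite w0 eqxx in Ex0.
Qed.

Lemma trivial_zero_infinity (F : fieldType) (n : nat) (D E : 'M[F]_n) :
  trivial_kernel (star_sylvester D E) -> \det D = 0 -> \det E = 0 -> False.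
Proof.
move=> tk /det_eq0P[x x0 Dx] /det_eq0P[y y0 Ey].
have Ex0 : E *m x != 0.
  by apply: contra_neq x0 => Ex; apply: (trivial_common_kernel tk).
have Dy0 : D *m y != 0.
  by apply: contra_neq y0 => Dy; apply: (trivial_common_kernel tk).
have : x *m (D *m y)^T + (- 1) *: (y *m (E *m x)^T) = 0.
  apply: tk; rewrite star_sylvesterD star_sylvesterZ !star_sylvester_outer Dx Ey.
  by rewrite mul0mx trmx0 mulmx0 addr0 add0r scaleN1r subrr.
(* [D] kills the first term and leaves - (D y) (E x)^T, a product of nonzero vectors. *)
move/(congr1 (mulmx D)); rewrite mulmxDr -scalemxAr !mulmxA Dx mul0mx add0r.
rewrite scaleN1r mulmx0 => /eqP; rewrite oppr_eq0 => /eqP/outer_eq0[z0|z0].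
- by rewrite z0 eqxx in Dy0.
- by rewrite z0 eqxx in Ex0.
Qed.

Lemma trivial_plane_kernel (F : fieldType) (n : nat) (D E : 'M[F]_n) :
  trivial_kernel (star_sylvester D E) -> ~ plane_kernel (D - E).
Proof.
move=> tk [x [z [j [Mx Mz xj zj z0]]]].
have Dx : D *m x = E *m x by apply/eqP; rewrite -subr_eq0 -mulmxBl Mx.
have Dz : D *m z = E *m z by apply/eqP; rewrite -subr_eq0 -mulmxBl Mz.
have /cV0Pn[k Ezk] : E *m z != 0.
  apply: contra_neq z0 => Ez; apply: (trivial_common_kernel tk) => //.
  by rewrite Dz.
have : x *m (E *m z)^T + (- 1) *: (z *m (E *m x)^T) = 0.
  apply: tk; rewrite star_sylvesterD star_sylvesterZ !star_sylvester_outer Dx Dz.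
  apply/matrixP => a b; rewrite !(mxE, outerE, big_ord1).
  by ring.
(* In row [j] only the first term survives, as [z j 0 = 0]. *)
move/matrixP/(_ j k); rewrite [LHS]mxE [X in _ + X]mxE !outerE zj mul0r mulr0 addr0.
by rewrite [RHS]mxE => /eqP; rewrite mulf_eq0 (negPf xj) (negPf Ezk).
Qed.

Lemma trivial_jordan_chain (F : numFieldType) (n : nat) (D E : 'M[F]_n) :
  trivial_kernel (star_sylvester D E) -> ~ jordan_chain D E.
Proof.
move=> tk [x [z [x0 Mx Mz]]].
have Dx : D *m x = E *m x by apply/eqP; rewrite -subr_eq0 -mulmxBl Mx.
have Dz : D *m z = E *m z + E *m x by rewrite -Mz mulmxBl addrC subrK.
have Ex0 : E *m x != 0.
  by apply: contra_neq x0 => Ex; apply: (trivial_common_kernel tk) => //; rewrite Dx.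
(* The first term contributes 2 (E x) (E x)^T, offsetting the excess E x of D z over E z. Applying D
   - E then leaves only -2 (E x) (E x)^T. *)
have : x *m (E *m x)^T + 2 *: (x *m (E *m z)^T) + (- 2) *: (z *m (E *m x)^T) = 0.
  apply: tk; rewrite !star_sylvesterD !star_sylvesterZ !star_sylvester_outer Dx Dz.
  by apply/matrixP => a b; rewrite !(mxE, outerE, big_ord1); ring.
move/(congr1 (mulmx (D - E))); rewrite !mulmxDr -!scalemxAr !mulmxA Mx Mz !mul0mx.
rewrite scaler0 !add0r mulmx0 => /eqP; rewrite scaler_eq0 oppr_eq0 pnatr_eq0 /=.
by move=> /eqP/outer_eq0; case=> Ex; rewrite Ex eqxx in Ex0.
Qed.

(** * Triviality of the kernel *)

(** [V] is the equation kept by all intermediate matrices and [K] the factor that is not peeled off: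
    1 for Sylvester, D - 1 for T-Sylvester. Cayley-Hamilton supplies the vanishing product. *)
Lemma root_peeling (F : fieldType) (n : nat) (D K : 'M[F]_n.+1)
    (V : 'M[F]_n.+1 -> Prop) (rs : seq F) :
  (forall z Y, V Y -> V ((D - z%:M) *m Y)) ->
  (forall z Y, z \in rs -> V Y -> K *m ((D - z%:M) *m Y) = 0 -> K *m Y = 0) ->
  forall Z, V Z -> horner_mx D (\prod_(z <- rs) ('X - z%:P)) *m Z = 0 ->
  K *m Z = 0.
Proof.
move=> VD; elim: rs => [|z rs IH] Kz Z VZ.
  by rewrite big_nil rmorph1 mul1mx => ->; rewrite mulmx0.
rewrite big_cons mulrC rmorphM rmorphB /= horner_mx_X horner_mx_C -mulmxA => hZ.
apply: (Kz z) => //; first by rewrite mem_head.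
apply: IH hZ => [t Y trs|]; [|exact: VD].
by apply: Kz; rewrite inE trs orbT.
Qed.

Lemma char_poly_roots (F : closedFieldType) (n : nat) (D : 'M[F]_n) :
  exists2 rs, char_poly D = \prod_(z <- rs) ('X - z%:P) &
    forall z, z \in rs -> \det (D - z%:M) = 0.
Proof.
have [rs def_p] := closed_field_poly_normal (char_poly D).
rewrite (eqP (char_poly_monic D)) scale1r in def_p; exists rs => // z.
rewrite -root_prod_XsubC -def_p rootE /char_poly -horner_evalE -det_map_mx.
rewrite -oppr0 => /eqP zr.
have -> : D - z%:M = - map_mx (horner_eval z) (char_poly_mx D).
  by apply/matrixP => i j; rewrite !mxE /horner_eval !hornerE hornerMn hornerX opprB.
by rewrite -scaleN1r detZ zr oppr0 mulr0.
Qed.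

(** The peeling is done on X = D X D^T, which, unlike X^T = - D X, survives left multiplication by D
    - z. *)
Lemma stein_trivial_kernel (F : numClosedFieldType) (n : nat) (D : 'M[F]_n.+1) :
  (forall l mu, \det (D - l%:M) = 0 -> \det (D - mu%:M) = 0 -> l * mu = 1 ->
     l = 1) ->
  ~ plane_kernel (D - 1%:M) -> ~ jordan_chain D 1%:M ->
  trivial_kernel (star_sylvester D 1%:M).
Proof.
move=> recip nplane nchain X; rewrite /star_sylvester mul1mx => DX.
have XT : X^T = - (D *m X) by apply/eqP; rewrite -addr_eq0 addrC DX.
pose V (Y : 'M[F]_n.+1) := Y = D *m Y *m D^T.
have VX : V X by rewrite /V -[LHS]trmxK XT linearN /= trmx_mul XT mulNmx opprK.
have [rs def_p rsP] := char_poly_roots D.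
have M1X : (D - 1%:M) *m X = 0.
  apply: (root_peeling (V := V) (rs := rs) _ _ VX).
  - move=> z Y VY; rewrite /V {1}VY !mulmxA; congr (_ *m _ *m _).
    by rewrite mulmxBl mulmxBr scalar_mxC.
  - move=> z Y zrs VY; rewrite mulmxA.
    have -> : (D - 1%:M) *m (D - z%:M) = (D - z%:M) *m (D - 1%:M).
      by apply: comm_mxB; [apply: comm_mx_sym; apply: comm_mxB|];
        do ?[exact: comm_mx_refl | exact: comm_mx_scalar].
    rewrite -mulmxA; set W := (D - 1%:M) *m Y => hW.
    have VW : W = D *m W *m D^T.
      rewrite {1}/W [in LHS]VY !mulmxA; congr (_ *m _ *m _).
      by rewrite mulmxBl mulmxBr scalar_mxC.
    apply/matrixP => i j; rewrite [RHS]mxE; apply/eqP; case: eqP => // /eqP Wij.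
    (* For z = 1, (D - 1) Y = W and (D - 1) W = 0 give a Jordan chain. Otherwise D W = z W turns W =
       D W D^T into W^T = z D W^T, so 1/z is an eigenvalue as well. *)
    have [z1|z1] := eqVneq z 1.
      case: nchain; exists (col j W), (col j Y); split.
      + by apply/cV0Pn; exists i; rewrite mxE.
      + by rewrite colE mulmxA -z1 hW mul0mx.
      + by rewrite !colE !mulmxA mul1mx.
    have DW : D *m W = z *: W.
      by apply/eqP; rewrite -subr_eq0 -mul_scalar_mx -mulmxBl hW.
    have WT : W^T = z *: (D *m W^T).
      by rewrite {1}VW DW trmx_mul trmxK linearZ /= -scalemxAr.
    have z0 : z != 0.
      apply/eqP => z0; move/matrixP/(_ j i)/eqP: WT.
      by rewrite z0 scale0r [X in X == _]mxE [X in _ == X]mxE (negPf Wij).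
    case/eqP: z1; apply: (recip z z^-1 (rsP z zrs) _ (divff z0)).
    apply/det_eq0P; exists (col i W^T).
      by apply/cV0Pn; exists j; rewrite mxE [_ j i]mxE.
    rewrite colE mulmxA mulmxBl mul_scalar_mx {2}WT scalerA mulVf // scale1r.
    by rewrite subrr mul0mx.
  - by rewrite -def_p Cayley_Hamilton mul0mx.
have DXX : D *m X = X by apply/eqP; rewrite -subr_eq0 -{2}[X]mul1mx -mulmxBl M1X.
apply/matrixP => i j; rewrite [RHS]mxE; apply/eqP; case: eqP => // /eqP Xij.
have Xas a b : X a b = - X b a by move/matrixP/(_ b a): XT; rewrite DXX !mxE.
(* Antisymmetry makes [X i i] zero, so index [i] separates the two columns. *)
case: nplane; exists (col j X), (col i X), i; split.
- by rewrite colE mulmxA M1X mul0mx.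
- by rewrite colE mulmxA M1X mul0mx.
- by rewrite mxE.
- rewrite mxE; apply/eqP; have /eqP := Xas i i.
  by rewrite -addr_eq0 -mulr2n mulrn_eq0.
- by apply/cV0Pn; exists j; rewrite mxE Xas oppr_eq0.
Qed.

Lemma star_sylvester_swap (F : fieldType) (n : nat) (D E X : 'M[F]_n) :
  star_sylvester E D X = (star_sylvester D E X)^T.
Proof. by rewrite /star_sylvester linearD /= trmxK addrC. Qed.

(** With D = E G and X = Y E^T, the operator becomes E (G Y + Y^T) E^T. *)
Lemma star_sylvester_unit_trivial (F : numClosedFieldType) (n : nat)
    (D E : 'M[F]_n.+1) :
  E \in unitmx ->
  (forall l mu, \det (D - l *: E) = 0 -> \det (D - mu *: E) = 0 ->
     l * mu = 1 -> l = 1) ->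
  ~ plane_kernel (D - E) -> ~ jordan_chain D E ->
  trivial_kernel (star_sylvester D E).
Proof.
move=> uE recip nplane nchain X LX.
have [G def_D] : exists G, D = E *m G by exists (invmx E *m D); rewrite mulKVmx.
have uET : E^T \in unitmx by rewrite unitmx_tr.
have [Y def_X] : exists Y, X = Y *m E^T.
  by exists (X *m invmx E^T); rewrite mulmxKV.
have shift z : D - z *: E = E *m (G - z%:M).
  by rewrite mulmxBr -def_D mul_mx_scalar.
have shift1 : D - E = E *m (G - 1%:M) by rewrite -shift scale1r.
have GY : star_sylvester G 1%:M Y = 0.
  apply: (can_inj (mulKmx uE)); apply: (can_inj (mulmxK uET)).
  rewrite mulmx0 mul0mx -[RHS]LX /star_sylvester def_X def_D mul1mx mulmxDr.
  by rewrite mulmxDl !trmx_mul trmxK !mulmxA.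
suff Y0 : Y = 0 by rewrite def_X Y0 mul0mx.
apply: stein_trivial_kernel GY => [l mu dl dm||].
- by apply: recip; rewrite shift det_mulmx ?dl ?dm mulr0.
- case=> x [z [j [Gx Gz xj zj z0]]]; apply: nplane; exists x, z, j.
  by rewrite shift1 -!mulmxA Gx Gz mulmx0.
- case=> x [z [x0 Gx Gz]]; apply: nchain; exists x, z.
  by rewrite shift1 -!mulmxA Gx Gz mulmx0 mul1mx.
Qed.

Lemma star_sylvester_trivialP (F : numClosedFieldType) (n : nat)
    (D E : 'M[F]_n.+1) :
  trivial_kernel (star_sylvester D E) <->
  [/\ forall l mu, \det (D - l *: E) = 0 -> \det (D - mu *: E) = 0 ->
        l * mu = 1 -> l = 1,
      ~ (\det D = 0 /\ \det E = 0),
      ~ plane_kernel (D - E) & ~ jordan_chain D E].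
Proof.
split=> [tk|[recip reg nplane nchain]].
  split.
  - by move=> l mu; apply: trivial_reciprocal tk.
  - by case; apply: trivial_zero_infinity tk.
  - exact: trivial_plane_kernel tk.
  - exact: trivial_jordan_chain tk.
have [dE|dE] := eqVneq (\det E) 0; last first.
  by apply: star_sylvester_unit_trivial; rewrite // unitmxE unitfE.
have dD : \det D != 0 by apply/eqP => dD; apply: reg.
suff tk : trivial_kernel (star_sylvester E D).
  by move=> X LX; apply: tk; rewrite star_sylvester_swap LX trmx0.
(* Exchanging [D] and [E] inverts the eigenvalues. *)
have flip l mu : l * mu = 1 -> \det (E - l *: D) = 0 -> \det (D - mu *: E) = 0.
  move=> lm dl; have -> : D - mu *: E = - mu *: (E - l *: D).
    by rewrite scalerBr scalerA mulNr mulrC lm !scaleNr scale1r opprK addrC.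
  by rewrite detZ dl mulr0.
apply: star_sylvester_unit_trivial; rewrite ?unitmxE ?unitfE //.
- move=> l mu dl dm lm; have ml : mu * l = 1 by rewrite mulrC.
  by apply: (recip l mu) => //; [exact: flip ml dm|exact: flip lm dl].
- case=> x [z [j [Mx Mz xj zj z0]]]; apply: nplane; exists x, z, j.
  by rewrite -opprB !mulNmx Mx Mz oppr0.
(* The sign of [z] absorbs that of E - D, and D x = E x adapts the right-hand side. *)
- case=> x [z [x0 Mx Mz]]; apply: nchain; exists x, (- z).
  have MEx : D *m x = E *m x.
    by apply/esym/eqP; rewrite -subr_eq0 -mulmxBl Mx.
  by rewrite -opprB !mulNmx mulmxN Mx Mz oppr0 opprK MEx.
Qed.

(** * The Sylvester operator *)

Lemma sylvester_trivialP (F : closedFieldType) (n : nat) (D G : 'M[F]_n.+1) :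
  trivial_kernel (fun X => D *m X + X *m G) <->
  forall z, eigenvalue D z -> eigenvalue (- G) z -> False.
Proof.
(* [eigenvalue] concerns row vectors; the determinant also yields the column eigenvector of [D]
   needed for the outer product. *)
have eig_det (M : 'M[F]_n.+1) z : eigenvalue M z = (\det (M - z%:M) == 0).
  rewrite /eigenvalue /eigenspace kermx_eq0 row_free_unit unitmxE unitfE.
  by rewrite negbK.
split=> [tk z|dis X LX].
  rewrite eig_det => /eqP/det_eq0P[x x0 Dx] /eigenvalueP[y Gy y0].
  have : x *m y^T^T = 0.
    apply: tk; rewrite trmxK mulmxA -[x *m y *m G]mulmxA.
    have -> : D *m x = z *: x.
      by apply/eqP; rewrite -subr_eq0 -mul_scalar_mx -mulmxBl Dx.
    have -> : y *m G = - (z *: y) by rewrite -Gy mulmxN opprK.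
    by rewrite mulmxN -scalemxAl -scalemxAr subrr.
  case/outer_eq0 => [x00|/eqP]; first by rewrite x00 eqxx in x0.
  by rewrite trmx_eq0 (negPf y0).
have [rs def_p rsP] := char_poly_roots D.
pose V (Y : 'M[F]_n.+1) := D *m Y + Y *m G = 0.
rewrite -[X]mul1mx; apply: (root_peeling (V := V) (D := D) (rs := rs)) => //.
- rewrite /V => z Y VY; rewrite mulmxA.
  have -> : D *m (D - z%:M) = (D - z%:M) *m D.
    by rewrite mulmxBl mulmxBr scalar_mxC.
  by rewrite -!mulmxA -mulmxDr VY mulmx0.
- rewrite /V => z Y zrs VY; rewrite !mul1mx => MY.
  have DY : D *m Y = z *: Y.
    by apply/eqP; rewrite -subr_eq0 -mul_scalar_mx -mulmxBl MY.
  (* Since D Y = z Y, the equation becomes Y (- G - z) = 0, whose right factor is invertible by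
     disjointness of the spectra. *)
  have YG : Y *m (- G - z%:M) = 0.
    rewrite mulmxBr mulmxN mul_mx_scalar -DY -opprD addrC VY oppr0 //.
  have dG : - G - z%:M \in unitmx.
    rewrite unitmxE unitfE -eig_det; apply/negP => /(dis z); apply.
    by rewrite eig_det rsP.
  by rewrite -(mulmxK dG Y) YG mul0mx.
- by rewrite -def_p Cayley_Hamilton mul0mx.
Qed.

Lemma unique_solutionP (F : fieldType) (n : nat) (L : 'M[F]_n -> 'M[F]_n)
    (C : 'M[F]_n) :
  linear L -> (exists! X, L X = C) <-> trivial_kernel L.
Proof.
move=> linL.
pose lL := GRing.isLinear.Build F 'M[F]_n 'M[F]_n *:%R L linL.
pose f : {linear 'M[F]_n -> 'M[F]_n} := HB.pack L lL.
have Lf X : L X = f X by [].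
split=> [[X [LX uX]] Y LY|tk].
  apply: (addrI X); rewrite addr0; apply/esym/uX.
  by rewrite Lf linearD -!Lf LX LY addr0.
(* In finite dimension injectivity gives surjectivity: the square matrix of [f] on vectorised
   matrices is invertible. *)
have uL : lin_mx f \in unitmx.
  rewrite -row_free_unit -kermx_eq0; apply/rowV0P => v /sub_kermxP.
  rewrite mul_rV_lin => /(canRL mxvecK); rewrite linear0 -Lf => /tk.
  by move/(canRL vec_mxK); rewrite linear0.
exists (vec_mx (mxvec C *m invmx (lin_mx f))); split=> [|Y LY].
  by apply: (can_inj mxvecK); rewrite Lf -mul_rV_lin mulmxKV.
by apply: (can_inj mxvecK); rewrite vec_mxK -LY Lf -mul_vec_lin mulmxK.
Qed.

(** * From real to complex matrices *)

(** Real-linear forms on the complex numbers, treating Re and Im uniformly. *)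
Definition real_functional (R : realType) (h : R[i] -> R) : Prop :=
  [/\ h 0 = 0, {morph h : x y / x + y} &
      forall a z, h (real_complex R a * z) = a * h z].

Lemma real_functional_Re (R : realType) : real_functional (@complex.Re R).
Proof.
by split=> // [[a b] [c d]|a [b c]] //=; rewrite mul0r subr0.
Qed.

Lemma real_functional_Im (R : realType) : real_functional (@complex.Im R).
Proof.
by split=> // [[a b] [c d]|a [b c]] //=; rewrite mul0r addr0.
Qed.

Lemma map_complexify_mull (R : realType) (h : R[i] -> R) (n : nat)
    (A : 'M[R]_n) (Z : 'M[R[i]]_n) :
  real_functional h -> map_mx h (complexify A *m Z) = A *m map_mx h Z.
Proof.
case=> h0 hD hM; apply/matrixP => i j; rewrite !mxE (big_morph h hD h0).
by apply: eq_bigr => k _; rewrite !mxE hM.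
Qed.

Lemma map_complexify_mulr (R : realType) (h : R[i] -> R) (n : nat)
    (A : 'M[R]_n) (Z : 'M[R[i]]_n) :
  real_functional h -> map_mx h (Z *m complexify A) = map_mx h Z *m A.
Proof.
case=> h0 hD hM; apply/matrixP => i j; rewrite !mxE (big_morph h hD h0).
by apply: eq_bigr => k _; rewrite !mxE mulrC hM mulrC.
Qed.

Lemma map_real_functionalD (R : realType) (h : R[i] -> R) (n : nat)
    (X Y : 'M[R[i]]_n) :
  real_functional h -> map_mx h (X + Y) = map_mx h X + map_mx h Y.
Proof. by case=> _ hD _; apply/matrixP => i j; rewrite !mxE hD. Qed.

(** The entrywise real and imaginary parts of a complex kernel element are real kernel elements. *)
Lemma complexify_trivial_kernel (R : realType) (n : nat)
    (L : 'M[R]_n -> 'M[R]_n) (Lc : 'M[R[i]]_n -> 'M[R[i]]_n) :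
  (forall X, Lc (complexify X) = complexify (L X)) ->
  (forall h Z, real_functional h -> L (map_mx h Z) = map_mx h (Lc Z)) ->
  trivial_kernel L <-> trivial_kernel Lc.
Proof.
move=> LcC Lh; split=> [tk Z LZ|tk X LX].
  have h0 h : real_functional h -> map_mx h Z = 0.
    move=> rh; apply: tk; rewrite Lh // LZ; case: rh => h0 _ _.
    by apply/matrixP => i j; rewrite !mxE.
  apply/matrixP => i j; rewrite [RHS]mxE; apply/eqP; rewrite eq_complex.
  have /matrixP/(_ i j) := h0 _ (real_functional_Re R).
  have /matrixP/(_ i j) := h0 _ (real_functional_Im R).
  by rewrite !mxE => -> ->; rewrite !eqxx.
have /matrixP cX0 : complexify X = 0.
  by apply: tk; rewrite LcC LX /complexify map_mx0.
apply/matrixP => i j; have := cX0 i j; rewrite !mxE => /(congr1 (@complex.Re R)).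
by [].
Qed.

Lemma complexify_sylvester (R : realType) (n : nat) (D G : 'M[R]_n) :
  trivial_kernel (fun X => D *m X + X *m G) <->
  trivial_kernel (fun X => complexify D *m X + X *m complexify G).
Proof.
apply: complexify_trivial_kernel => [X|h Z rh].
  by rewrite /complexify map_mxD !map_mxM.
by rewrite map_real_functionalD // map_complexify_mull // map_complexify_mulr.
Qed.

Lemma complexify_star_sylvester (R : realType) (n : nat) (D E : 'M[R]_n) :
  trivial_kernel (star_sylvester D E) <->
  trivial_kernel (star_sylvester (complexify D) (complexify E)).
Proof.
apply: complexify_trivial_kernel => [X|h Z rh]; rewrite /star_sylvester.
  by rewrite /complexify map_mxD -map_trmx !map_mxM.
by rewrite map_real_functionalD // -map_trmx !map_complexify_mull.
Qed.

(** * Multiplication of the two equations by P^T *)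

Lemma trivial_kernel_mulmx (F : fieldType) (n : nat) (U : 'M[F]_n)
    (L : 'M[F]_n -> 'M[F]_n) :
  U \in unitmx ->
  trivial_kernel L <-> trivial_kernel (fun X => U *m L X).
Proof.
move=> uU; split=> tk X LX; apply: tk; last by rewrite LX mulmx0.
by rewrite -[LHS](mulKmx uU) LX mulmx0.
Qed.

Lemma eq_trivial_kernel (F : fieldType) (n : nat) (L L' : 'M[F]_n -> 'M[F]_n) :
  L =1 L' -> trivial_kernel L <-> trivial_kernel L'.
Proof. by move=> eqL; split=> tk X; [rewrite -eqL|rewrite eqL]; apply: tk. Qed.

Lemma perm_P_orthogonal (R : nzRingType) (m k : nat) :
  (perm_P R m k)^T *m perm_P R m k = 1%:M.
Proof. by rewrite /perm_P tr_perm_mx -perm_mxM mulVg perm_mx1. Qed.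

Lemma perm_P_unit (R : fieldType) (m k : nat) : (perm_P R m k)^T \in unitmx.
Proof. exact: (mulmx1_unit (perm_P_orthogonal R m k)).1. Qed.

Lemma unique_fPP (R : realType) (m k : nat) (A B C : 'M[R]_m) :
  (exists! X, A *m X + fP k X *m B = C) <->
  trivial_kernel
    (fun X => (perm_P R m k)^T *m A *m X + X *m ((perm_P R m k)^T *m B)).
Proof.
pose L (X : 'M[R]_m) := A *m X + fP k X *m B.
have linL : linear L.
  move=> c X Y; rewrite /L /fP !(mulmxDr, mulmxDl) -!(scalemxAr, scalemxAl).
  by rewrite scalerDr addrACA.
apply: (iff_trans (unique_solutionP C linL)).
apply: (iff_trans (trivial_kernel_mulmx L (perm_P_unit R m k))).
apply: eq_trivial_kernel => X; rewrite /L /fP mulmxDr !mulmxA.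
by rewrite perm_P_orthogonal mul1mx.
Qed.

Lemma unique_fRP (R : realType) (m k : nat) (A B C : 'M[R]_m) :
  (exists! X, A *m X + fR k X *m B = C) <->
  trivial_kernel
    (star_sylvester ((perm_P R m k)^T *m A) (B^T *m perm_P R m k)).
Proof.
pose L (X : 'M[R]_m) := A *m X + fR k X *m B.
have linL : linear L.
  move=> c X Y; rewrite /L /fR [(c *: X + Y)^T]linearP /= !(mulmxDr, mulmxDl).
  by rewrite -!(scalemxAr, scalemxAl) scalerDr addrACA.
apply: (iff_trans (unique_solutionP C linL)).
apply: (iff_trans (trivial_kernel_mulmx L (perm_P_unit R m k))).
apply: eq_trivial_kernel => X; rewrite /L /fR /star_sylvester mulmxDr.
by rewrite !trmx_mul trmxK !mulmxA perm_P_orthogonal mul1mx.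
Qed.

(** * The spectral conditions *)

Lemma simple_eigenvalue_one (R : realType) (m : nat) (D E : 'M[R]_m) :
  (forall l mu, \det (complexify D - l *: complexify E) = 0 ->
     \det (complexify D - mu *: complexify E) = 0 -> l * mu = 1 -> l = 1) ->
  \det (complexify D - complexify E) = 0 ->
  simple_eigenvalue D E 1 <->
  ~ plane_kernel (complexify D - complexify E) /\
  ~ jordan_chain (complexify D) (complexify E).
Proof.
(* The pencil is regular: otherwise 2 and 1/2 would both be eigenvalues, against [recip]. *)
move=> recip d1; apply: simple_root_pencil => //; apply/eqP => p0.
have all0 l : \det (complexify D - l *: complexify E) = 0.
  by rewrite -horner_det_pencil p0 horner0.
have n2 : (2 : R[i]) != 0 by rewrite pnatr_eq0.
by have /eqP := recip 2 2^-1 (all0 _) (all0 _) (divff n2); rewrite (eqr_nat _ 2 1).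
Qed.

Lemma plane_kernel_det (F : fieldType) (n : nat) (M : 'M[F]_n) :
  plane_kernel M -> \det M = 0.
Proof.
by case=> _ [z [_ [_ Mz _ _ z0]]]; apply/det_eq0P; exists z.
Qed.

Lemma jordan_chain_det (F : fieldType) (n : nat) (D E : 'M[F]_n) :
  jordan_chain D E -> \det (D - E) = 0.
Proof. by case=> x [_ [x0 Mx _]]; apply/det_eq0P; exists x. Qed.

Lemma star_sylvester_spectrumP (R : realType) (n : nat) (D E : 'M[R]_n.+1) :
  trivial_kernel (star_sylvester D E) <->
  (forall l1 l2 : option R[i],
     (pencil_spectrum D E `\ Some 1) l1 ->
     (pencil_spectrum D E `\ Some 1) l2 -> ~ reciprocal l1 l2) /\
  (pencil_spectrum D E (Some 1) -> simple_eigenvalue D E 1).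
Proof.
apply: (iff_trans (complexify_star_sylvester D E)).
apply: (iff_trans (star_sylvester_trivialP _ _)).
have D0 : complexify D - 0 *: complexify E = complexify D.
  by rewrite scale0r subr0.
split=> [[recip reg nplane nchain]|[spec simple1]].
  split=> [[l|] [mu|] [/= dl l1] [/= dm m1] //= lm|].
  - exact: l1 (congr1 Some (recip l mu dl dm lm)).
  - by move: dl; rewrite lm D0 => dD; apply: reg.
  - by move: dm; rewrite lm D0 => dD; apply: reg.
  - rewrite /= scale1r => d1.
    exact: (simple_eigenvalue_one recip d1).2 (conj nplane nchain).
have recip l mu : \det (complexify D - l *: complexify E) = 0 ->
    \det (complexify D - mu *: complexify E) = 0 -> l * mu = 1 -> l = 1.
  (* If [l] is not 1, neither is [mu], so the pair lies in the punctured spectrum. *)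
  move=> dl dm lm; apply/eqP/negPn/negP => /eqP l1.
  apply: (spec (Some l) (Some mu)) => //; split=> //= -[e1]; apply: l1 => //.
  by rewrite -lm e1 mulr1.
have simple d1 := (simple_eigenvalue_one recip d1).1.
rewrite /= scale1r in simple1; split=> // [[dD dE]|pk|jc].
- apply: (spec (Some 0) None _ _ erefl); last by split.
  split; first by rewrite /= D0.
  by case=> /esym/eqP; rewrite (negPf (oner_neq0 _)).
- have d1 := plane_kernel_det pk.
  by have [] := simple d1 (simple1 d1).
- have d1 := jordan_chain_det jc.
  by have [] := simple d1 (simple1 d1).
Qed.

Theorem theorem4p2 (R : realType) (m : nat) (hm : (1 <= m)%N)
    (A B C : 'M[R]_m) (k : nat) (hk : (1 <= k <= m`!)%N) :
  ((exists! X : 'M[R]_m, A *m X + fP k X *m B = C) <->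
   spectrum ((perm_P R m k)^T *m A) `&`
     spectrum (- ((perm_P R m k)^T *m B)) = set0)
  /\
  ((exists! X : 'M[R]_m, A *m X + fR k X *m B = C) <->
   (forall l1 l2 : option R[i],
      (pencil_spectrum ((perm_P R m k)^T *m A) (B^T *m perm_P R m k)
         `\ Some 1) l1 ->
      (pencil_spectrum ((perm_P R m k)^T *m A) (B^T *m perm_P R m k)
         `\ Some 1) l2 ->
      ~ reciprocal l1 l2)
   /\
   (pencil_spectrum ((perm_P R m k)^T *m A) (B^T *m perm_P R m k) (Some 1) ->
    simple_eigenvalue ((perm_P R m k)^T *m A) (B^T *m perm_P R m k) 1)).
Proof.
case: m hm A B C hk => [//|n] _ A B C _; split; last first.
  exact: iff_trans (unique_fRP k A B C) (star_sylvester_spectrumP _ _).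
apply: (iff_trans (unique_fPP k A B C)).
apply: (iff_trans (complexify_sylvester _ _)).
apply: (iff_trans (sylvester_trivialP _ _)).
have cN : complexify (- ((perm_P R n.+1 k)^T *m B)) =
    - complexify ((perm_P R n.+1 k)^T *m B) by rewrite /complexify map_mxN.
rewrite /spectrum cN; split=> [dis|/seteqP[dis _] z e1 e2].
  by apply/seteqP; split=> [z [e1 e2]|z []]; exact: (dis z e1 e2).
exact: dis z (conj e1 e2).
Qed.
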